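(* Fix $A\in RV(\alpha)$ with $\alpha\in(0,\frac12)$, and let $\zeta:(0,\infty)\to(0,\infty)$ be an arbitrary non-decreasing function with $\lim_{x\to\infty}\zeta(x)=\infty$. Then there exists a probability $F$ on $[0,\infty)$ satisfying $\overline F(x)\sim\frac1{A(x)}$ as $x\to\infty$, and such that $$F(x+I)=O\!\left(\frac{\zeta(x)}{x\,A(x)}\right)\qquad (x\to\infty),$$ for which the strong renewal theorem (SRT) fails.
   Context: $RV(\gamma)$: $f\in RV(\gamma)$ iff $f(x)=x^\gamma\ell(x)$ with $\ell$ slowly varying at infinity. $\overline F(x):=F((x,\infty))$; $f\sim g$ means $f/g\to1$. Standing normalization (without loss of generality): $A:[0,\infty)\to(0,\infty)$ is differentiable, strictly increasing, $A'(s)\sim\alpha A(s)/s$, $A(0)=\frac12$, $A(1)=1$; $a_n:=A^{-1}(n)$. $F$ is arithmetic if supported by $h\mathbb{Z}$ for some $h>0$; the maximal such $h$ is its arithmetic span. $I=(-h,0]$, where $h$ is the arithmetic span of $F$ if $F$ is arithmetic and any fixed positive number otherwise. Let $S_0=0$, $S_n=X_1+\dots+X_n$ with $X_i$ i.i.d. of law $F$; $S_n/a_n$ converges in law to a stable random variable $Y$ of index $\alpha$. $U(\mathrm{d}x):=\sum_{n\ge0}\mathbb{P}(S_n\in\mathrm{d}x)$. The SRT is the relation $U((x-h,x])\sim\mathsf{C}\,h\,\frac{A(x)}{x}$ as $x\to\infty$, with $\mathsf{C}:=\alpha\,\mathbb{E}[Y^{-\alpha}\mathbf{1}_{\{Y>0\}}]$.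 *)

(* Defs.v *)
From HB Require Import structures.
From mathcomp Require Import all_boot all_order all_algebra.
From mathcomp Require Import all_classical all_reals all_analysis.

Set Implicit Arguments.
Unset Strict Implicit.
Unset Printing Implicit Defensive.

Import Order.TTheory GRing.Theory Num.Theory.
Import numFieldNormedType.Exports.

Local Open Scope classical_set_scope.
Local Open Scope ring_scope.

(* f ~ g at +oo, read as f / g --> 1 (and not as f = g + o(g)). *)
Definition asymp (R : realType) (f g : R -> R) : Prop :=
  f x / g x @[x --> +oo] --> (1 : R).

(* Landau's f = O(g) at +oo; the library's =O_F needs F to be a canonical
   filter_on, which +oo is not. *)
Definition bigO_pinfty (R : realType) (f g : R -> R) : Prop :=
  exists K : R, \forall x \near +oo, `|f x| <= K * `|g x|.

Definition slowly_varying (R : realType) (l : R -> R) : Prop :=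
  exists M : R, [/\ measurable_fun `]M, +oo[ l,
    (forall x : R, M < x -> 0 < l x) &
    (forall t : R, 0 < t -> l (t * x) / l x @[x --> +oo] --> (1 : R))].

Definition RV (R : realType) (gamma : R) (f : R -> R) : Prop :=
  exists2 l : R -> R, slowly_varying l &
    \forall x \near +oo, f x = x `^ gamma * l x.

(* A is a function on [0, +oo[: its values at negative reals are irrelevant,
   and differentiability at 0 is one-sided. *)
Record normalized (R : realType) (alpha : R) (A : R -> R) : Prop := Normalized {
  normalized_gt0 : forall s : R, 0 <= s -> 0 < A s ;
  normalized_incr : forall s t : R, 0 <= s -> s < t -> A s < A t ;
  normalized_derivable : forall s : R, 0 < s -> derivable A s 1 ;
  normalized_derivable0 : cvg ((A t - A 0) / t @[t --> 0^'+]) ;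
  normalized_derive : asymp (A^`())%classic (fun s => alpha * A s / s) ;
  normalized_at0 : A 0 = 2^-1 ;
  normalized_at1 : A 1 = 1
}.

(* a_n = A^{-1}(n).  For A normalized and regularly varying of positive index
   it exists and is unique as soon as n >= 1 (A 0 = 1/2, so a_0 is junk). *)
Definition norming (R : realType) (A : R -> R) (n : nat) : R :=
  get [set s : R | 0 <= s /\ A s = n%:R].

Definition lattice (R : realType) (h : R) : set R :=
  [set x | exists k : int, x = k%:~R * h].

Section laws.
Context {R : realType}.
Implicit Types mu nu F Y : probability R R.

Definition supported_by_lattice F (h : R) : Prop := F (lattice h) = 1%E.

Definition arithmetic F : Prop := exists2 h : R, 0 < h & supported_by_lattice F h.

Definition arithmetic_span F (h : R) : Prop :=
  [/\ 0 < h, supported_by_lattice F h &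
      forall h' : R, 0 < h' -> supported_by_lattice F h' -> h' <= h].

(* The lengths h of I = ]-h, 0] allowed for F. *)
Definition admissible_step F (h : R) : Prop :=
  0 < h /\ (arithmetic F -> arithmetic_span F h).

Definition convolution mu nu : set R -> \bar R :=
  pushforward (mu \x nu)%E (fun z : R * R => z.1 + z.2).

Section convolution_probability.
Variables mu nu : probability R R.

Let measurable_add : measurable_fun [set: R * R] (fun z : R * R => z.1 + z.2).
Proof. exact: measurable_realfun.measurable_funD. Qed.

Let convolution0 : convolution mu nu set0 = 0%E.
Proof. by rewrite /convolution /pushforward preimage_set0 measure0. Qed.

Let convolution_ge0 B : (0 <= convolution mu nu B)%E.
Proof. exact: measure_ge0. Qed.

Let convolution_sigma_additive : semi_sigma_additive (convolution mu nu).
Proof.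
move=> B mB tB mUB; rewrite /convolution /pushforward preimage_bigcup.
apply: measure_semi_sigma_additive.
- by move=> n; rewrite -[X in measurable X]setTI; exact: measurable_add.
- apply/trivIsetP => i j _ _ ij; rewrite -preimage_setI.
  by move/trivIsetP : tB => -> //; rewrite preimage_set0.
- rewrite -preimage_bigcup -[X in measurable X]setTI; exact: measurable_add.
Qed.

HB.instance Definition _ := isMeasure.Build _ _ _ (convolution mu nu)
  convolution0 convolution_ge0 convolution_sigma_additive.

Let convolution_setT : convolution mu nu [set: R] = 1%E.
Proof.
rewrite /convolution /pushforward preimage_setT -setXTT.
rewrite product_measure1E//.
by rewrite -[RHS]mule1; congr (_ * _)%E; exact: probability_setT.
Qed.

HB.instance Definition _ := Measure_isProbability.Build _ _ _
  (convolution mu nu) convolution_setT.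

End convolution_probability.

(* The law of S_n = X_1 + ... + X_n, the X_i being i.i.d. of law F. *)
Fixpoint walk_law F (n : nat) : probability R R :=
  if n is m.+1 then convolution (walk_law F m) F else \d_(0 : R).

Definition renewal F (B : set R) : \bar R := (\sum_(0 <= n <oo) walk_law F n B)%E.

(* S_n / b_n converges in law to Y, tested on bounded continuous functions. *)
Definition rescaled_walk_cvg F (b : nat -> R) Y : Prop :=
  forall f : R -> R, continuous f -> (exists M : R, forall x, `|f x| <= M) ->
    (\int[walk_law F n]_s (f (s / b n))%:E)%E @[n --> \oo]
      --> (\int[Y]_y (f y)%:E)%E.

(* C = alpha * E[Y^(-alpha) 1_{Y > 0}] *)
Definition SRT_const (alpha : R) Y : R :=
  alpha * fine (\int[Y]_(y in `]0%R, +oo[) (y `^ (- alpha))%:E)%E.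

(* U(]x - h, x]) ~ C h A(x) / x, where U is valued in [0, +oo]. *)
Definition SRT (alpha : R) (A : R -> R) F Y (h : R) : Prop :=
  (renewal F `](x - h)%R, x] * ((SRT_const alpha Y * h * A x / x)^-1)%:E)%E
    @[x --> +oo] --> 1%E.

End laws.

(* Main.v *)
Require Import Defs.
From mathcomp Require Import all_boot all_order all_algebra.
From mathcomp Require Import all_classical all_reals all_analysis.
From mathcomp Require Import zify ring lra.

Import Order.TTheory GRing.Theory Num.Theory.
Import numFieldNormedType.Exports.

Local Open Scope classical_set_scope.
Local Open Scope ring_scope.

Set Implicit Arguments.
Unset Strict Implicit.

(** The law F lives on the natural numbers.  It consists of a regular part with
    tail 1 / A(n), of a sparse sequence of spikes, and of an atom at 1 which
    makes the total mass 1 and the arithmetic span 1.  The spike number k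
    consists of atoms of equal mass sigma ^ k / (x A(x)) on the integers of
    [x - w, x], where x = 2 ^ (k + 2) w.

    The spikes are too light to be seen in the tail: the mass of the spike at x
    is of order (sigma / 2) ^ k / A(x), and sigma < 2.  They respect the local
    bound as soon as w is so large that zeta(w) exceeds (2 sigma) ^ k.

    They are nevertheless heavy enough to break the strong renewal theorem at x.
    The walk can reach x by one jump from [0, w] into the spike, which may
    happen at any of its first steps ([one_big_jump]).  As long as n is at most
    a small multiple of A(w), the n other steps have a sum in [0, w] with
    probability at least 1/2 ([small_sum_ge], where the truncated mean is
    bounded by Karamata's estimate [sum_inv_le]).  Summing n over this range
    yields U({x}) >= const * sigma ^ k A(w) ^ 2 / (x A(x)) ([renewal_ge]).  Now
    A(x) <= r ^ (k + 2) A(w), where r is any doubling constant of A larger than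
    2 ^ alpha, and hence U({x}) >= const * (sigma / r ^ 2) ^ k A(x) / x.  As
    alpha < 1/2, one can take r ^ 2 < 2 and then r ^ 2 < sigma < 2
    ([exists_spiked_law]).  Then U({x}) / (A(x) / x) is unbounded, so that no
    real constant fits the strong renewal theorem ([not_SRT]), whatever the
    limit law Y of the rescaled walk may be.

    Since F lives on the natural numbers, the law of the walk is handled by
    means of powers of polynomials ([walk_law_ge]), and the lower bound on the
    renewal measure is an inequality between coefficients. *)

(** * Regularly varying functions at infinity *)

Section near_pinfty.
Variable R : realType.

Lemma near_pinfty_nat (P : R -> Prop) : (\forall x \near +oo, P x) ->
  exists N : nat, forall x, N%:R <= x -> P x.
Proof.
move=> [B [_ HB]]; exists (Num.truncn `|B|).+1 => x Nx; apply: HB.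
apply: le_lt_trans (ler_norm _) _; apply: lt_le_trans Nx; exact: truncnS_gt.
Qed.

Lemma nat_near_pinfty (P : R -> Prop) (N : nat) :
  (forall x, N%:R <= x -> P x) -> \forall x \near +oo, P x.
Proof.
move=> HN; near=> x; apply: HN; near: x.
by apply: nbhs_pinfty_ge; rewrite num_real.
Unshelve. all: by end_near. Qed.

Lemma truncn_bounds (x : R) : 0 <= x ->
  (Num.truncn x)%:R <= x /\ x < (Num.truncn x).+1%:R.
Proof. by move=> x0; rewrite truncn_le x0 truncnS_gt. Qed.

Lemma le_truncn (x : R) (N : nat) : N%:R <= x -> (N <= Num.truncn x)%N.
Proof. by move=> Nx; rewrite truncn_ge_nat// (le_trans _ Nx). Qed.

Lemma cvg_truncn (u : nat -> R) (l : R) :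
  u @ \oo --> l -> (fun x : R => u (Num.truncn x)) @ +oo --> l.
Proof.
move=> /cvgrPdist_le ul; apply/cvgrPdist_le => e e0.
have [N _ HN] := ul _ e0.
apply: (@nat_near_pinfty _ N) => x Nx; apply: HN; exact: le_truncn.
Qed.

End near_pinfty.

Lemma ltr_powR_gt1 (R : realType) (b x y : R) :
  1 < b -> x < y -> b `^ x < b `^ y.
Proof.
move=> b1 xy; have b0 : 0 < b by exact: lt_trans b1.
by rewrite /powR gt_eqF// ltr_expR ltr_pM2r// ln_gt0.
Qed.

Lemma RV_ratio (R : realType) (gamma t : R) (f : R -> R) :
  RV gamma f -> 0 < t -> f (t * x) / f x @[x --> +oo] --> t `^ gamma.
Proof.
move=> [l [M [_ lgt0 lsv]] fE] t0.
have : l (t * x) / l x * t `^ gamma @[x --> +oo] --> 1 * t `^ gamma.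
  by apply: cvgM; [exact: lsv|exact: cvg_cst].
rewrite mul1r; apply: cvg_trans; apply: near_eq_cvg.
case: fE => B [Breal fE].
near=> x.
have x0 : 0 < x by near: x; exact: nbhs_pinfty_gt.
have -> : f x = x `^ gamma * l x.
  by apply: fE; near: x; apply: nbhs_pinfty_gt.
have -> : f (t * x) = (t * x) `^ gamma * l (t * x).
  apply: fE; rewrite -ltr_pdivrMl//; near: x; apply: nbhs_pinfty_gt.
  by rewrite num_real.
rewrite powRM ?ltW// invfM.
have xg : x `^ gamma != 0 by rewrite gt_eqF// powR_gt0.
have lx : l x != 0.
  by rewrite gt_eqF// lgt0//; near: x; apply: nbhs_pinfty_gt; rewrite num_real.
by field; rewrite xg lx.
Unshelve. all: by end_near. Qed.

(** A bounded increasing function has a positive limit, hence a doubling ratio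
    tending to 1 rather than to 2 ^ alpha > 1. *)
Lemma normalized_cvg_pinfty (R : realType) (alpha : R) (A : R -> R) :
  0 < alpha -> RV alpha A -> normalized alpha A -> A x @[x --> +oo] --> +oo.
Proof.
move=> alpha0 A_RV [Agt0 Aincr _ _ _ _ _].
apply/cvgryPge => M; apply: contrapT => notge.
have AltM x : 0 <= x -> A x < M.
  move=> x0; rewrite ltNge; apply/negP => MAx; apply: notge.
  near=> y; apply: (le_trans MAx); apply: ltW; apply: Aincr => //.
  by near: y; apply: nbhs_pinfty_gt; rewrite num_real.
have Abnd : has_sup [set A x | x in [set x : R | 0 <= x]].
  split; first by exists (A 0), 0 => //=.
  by exists M => _ [x x0 <-]; exact/ltW/AltM.
set L := sup [set A x | x in [set x : R | 0 <= x]].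
have AleL x : 0 <= x -> A x <= L.
  by move=> x0; apply: sup_ubound; [case: Abnd|exists x].
have AL : A x @[x --> +oo] --> L.
  apply/cvgrPdist_lt => e e0.
  have [_ [y y0 <-] Ly] := sup_adherent e0 Abnd.
  near=> x.
  have yx : y < x by near: x; apply: nbhs_pinfty_gt; rewrite num_real.
  have := Aincr _ _ y0 yx; have := AleL _ (ltW (le_lt_trans y0 yx)).
  by rewrite -/L in Ly => ? ?; rewrite ger0_norm; lra.
have L0 : 0 < L by apply: lt_le_trans (Agt0 0 _) (AleL 0 _).
have A2L : A (2 * x) @[x --> +oo] --> L.
  apply: (@cvg_comp _ _ _ (fun x => 2 * x) A _ +oo) => //.
  apply/cvgryPge => B; near=> x.
  rewrite -ler_pdivrMl//; near: x; apply: nbhs_pinfty_ge; exact: num_real.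
have r1 : A (2 * x) / A x @[x --> +oo] --> (1 : R).
  have : A (2 * x) / A x @[x --> +oo] --> L / L.
    by apply: cvgM => //; apply: (@cvgV _ _ _ _ A) => //; exact: lt0r_neq0.
  by rewrite divff// lt0r_neq0.
have r2 := @RV_ratio R alpha 2 A A_RV (ltr0Sn _ _).
have r12 : (1 : R) = 2 `^ alpha := cvg_unique (@norm_hausdorff _ _) r1 r2.
have : (1 : R) < 2 `^ alpha.
  by rewrite -[ltLHS](@powRr0 _ 2) ltr_powR_gt1// ltr1n.
by rewrite -r12 ltxx.
Unshelve. all: by end_near. Qed.

(** The mean value theorem: since alpha < 1/2, the asymptotics of A' give
    A'(s) <= A(s) / (2 s) for large s. *)
Lemma normalized_increment (R : realType) (alpha : R) (A : R -> R) :
  0 < alpha -> alpha < 2^-1 -> normalized alpha A ->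
  exists n0 : nat, forall n, (n0 <= n)%N ->
    A n.+1%:R - A n%:R <= A n.+1%:R / (2 * n%:R).
Proof.
move=> alpha0 alpha1 [Agt0 Aincr Ad _ Aasymp _ _].
have : \forall s \near +oo,
    A^`()%classic s / (alpha * A s / s) <= (2 * alpha)^-1.
  apply: (cvgr_le 1) => //; rewrite invf_gt1; lra.
move=> [B [Breal HB]].
exists (Num.truncn `|B|).+1 => n nB.
have n0 : 0 < n%:R :> R by rewrite ltr0n; lia.
have Bn : B < n%:R.
  apply: le_lt_trans (ler_norm _) _; apply: lt_le_trans (truncnS_gt _) _.
  by rewrite ler_nat.
have nS : n%:R < n.+1%:R :> R by rewrite ltr_nat.
have [|||c cn ->] := @MVT R A (A^`()%classic) n%:R n.+1%:R.
- done.
- move=> x /[!in_itv]/= /andP[nx _].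
  rewrite derive1E; apply/derivableP/Ad; lra.
- apply: derivable_within_continuous => x /[!in_itv]/= /andP[nx _].
  apply: Ad; lra.
move: cn; rewrite in_itv/= => /andP[nc cS].
have c0 : 0 < c by lra.
have -> : n.+1%:R - n%:R = 1 :> R by rewrite -natrB// subSnn.
rewrite mulr1.
have Ac0 : 0 < A c by apply: Agt0; lra.
have := HB c (lt_trans Bn nc).
rewrite ler_pdivrMr; last by rewrite divr_gt0 ?mulr_gt0.
have -> : (2 * alpha)^-1 * (alpha * A c / c) = A c / (2 * c).
  by field; rewrite !gt_eqF.
move/le_trans; apply.
apply: ler_pM.
- exact: ltW.
- by rewrite invr_ge0 mulr_ge0// ltW.
- by apply/ltW/Aincr => //; apply: ltW.
- by rewrite lef_pV2 ?posrE ?mulr_gt0// ler_pM2l// ltW.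
Unshelve. all: by end_near. Qed.

(** The limit doubling ratio 2 ^ alpha has a square below 2 because
    alpha < 1/2, which leaves room for a doubling constant r = 2 ^ beta with
    alpha < beta < 1/2. *)
Lemma RV_double (R : realType) (alpha : R) (A : R -> R) :
  alpha < 2^-1 -> (forall x, 0 <= x -> 0 < A x) -> RV alpha A ->
  exists r : R, [/\ 0 < r, r ^+ 2 < 2 &
    exists N : nat, forall n, (N <= n)%N -> A (2 * n)%:R <= r * A n%:R].
Proof.
move=> alpha1 Agt0 A_RV.
pose beta := (alpha + 2^-1) / 2.
exists (2 `^ beta); split; first by rewrite powR_gt0.
  rewrite -powR_mulrn ?powR_ge0// -powRrM -[ltRHS](@powRr1 _ 2)//.
  by apply: ltr_powR_gt1; rewrite ?ltr1n// /beta; lra.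
have ab : 2 `^ alpha < 2 `^ beta.
  by apply: ltr_powR_gt1; rewrite ?ltr1n// /beta; lra.
have [N HN] := near_pinfty_nat (cvgr_le _ (RV_ratio A_RV (ltr0Sn R 1)) _ ab).
exists N => n Nn; have := HN n%:R; rewrite ler_nat => /(_ Nn).
by rewrite ler_pdivrMr ?Agt0// natrM.
Qed.

(** * Sequences with logarithmic slope at most 1/2 *)

Section sequence_facts.
Variables (R : realType) (a : nat -> R) (n0 : nat).
Hypotheses (a_gt0 : forall n, 0 < a n)
  (a_nd : {homo a : m n / (m <= n)%N >-> m <= n})
  (a_incr : forall n, (n0 <= n)%N -> a n.+1 - a n <= a n.+1 / (2 * n%:R)).

Lemma le_succ_double n : (n0 <= n)%N -> (0 < n)%N -> a n.+1 <= 2 * a n.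
Proof.
move=> n0n n_gt0; have := a_incr n0n.
have n1 : 1 <= n%:R :> R by rewrite ler1n.
have aS := a_gt0 n.+1.
have : a n.+1 / (2 * n%:R) <= a n.+1 / 2.
  rewrite ler_pM2l// lef_pV2 ?posrE//; lra.
lra.
Qed.

Lemma succ_ratio n : (n0 <= n)%N -> (0 < n)%N -> 1 - n%:R^-1 <= a n / a n.+1.
Proof.
move=> n0n n_gt0; rewrite ler_pdivlMr// mulrBl mul1r.
have n1 : 0 < n%:R :> R by rewrite ltr0n.
have := a_incr n0n; have := a_gt0 n.+1.
rewrite invfM mulrA [n%:R^-1 * _]mulrC.
have : 0 <= a n.+1 / n%:R by rewrite divr_ge0// ltW.
lra.
Qed.

(** Karamata's bound: the increments of n / a n are at least of order 1 / a n,
    because the logarithmic slope of a is at most 1/2 < 1, so the sum of the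
    1 / a i telescopes up to a constant factor. *)
Lemma sum_inv_le : exists2 C : R, 0 < C &
  forall w, (n0.+2 <= w)%N -> \sum_(i < w) (a i)^-1 <= C * w%:R / a w.
Proof.
set N := n0.+2; set T := \sum_(i < N) (a i)^-1.
have T0 : 0 <= T by rewrite sumr_ge0// => i _; rewrite invr_ge0 ltW.
have aN := a_gt0 N.
have N0 : 0 < N%:R :> R by rewrite ltr0n.
(* The second summand covers the initial segment, 8 the induction step. *)
exists (8 + T * a N / N%:R).
  by rewrite ltr_wpDr// divr_ge0// ?mulr_ge0// ltW.
set C := 8 + _.
have C8 : 8 <= C by rewrite lerDl divr_ge0// ?mulr_ge0// ltW.
elim=> [//|w IH]; rewrite leq_eqVlt => /predU1P[<-|].
  rewrite -/T /C mulrDl mulrDl.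
  have -> : T * a N / N%:R * N%:R / a N = T by field; rewrite !gt_eqF.
  by rewrite lerDr divr_ge0 ?mulr_ge0// ltW.
rewrite ltnS => Nw; rewrite big_ord_recr/=; apply: (le_trans (lerD (IH Nw) (lexx _))).
have w2 : 2 <= w%:R :> R by rewrite ler_nat; apply: leq_trans Nw.
have n0w : (n0 <= w)%N by apply: leq_trans Nw; rewrite /N; lia.
have w0 : (0 < w)%N by apply: leq_trans Nw.
have a2 := le_succ_double n0w w0; have ai := a_incr n0w.
have := a_gt0 w; have := a_gt0 w.+1.
move: a2 ai; set u := a w; set v := a w.+1 => vu uv v0 u0.
have W0 : 0 < w%:R :> R by lra.
have wuv : w%:R * (v - u) <= v / 2.
  move: uv; rewrite -(ler_pM2l W0); congr (_ <= _); field; lra.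
rewrite -natr1 -[leLHS](@mulfK _ (u * v)) ?mulf_neq0 ?gt_eqF//.
rewrite -[leRHS](@mulfK _ (u * v)) ?mulf_neq0 ?gt_eqF//.
rewrite ler_pM2r ?invr_gt0 ?mulr_gt0//.
have -> : (C * w%:R / u + u^-1) * (u * v) = C * w%:R * v + v by field; lra.
have -> : C * (w%:R + 1) / v * (u * v) = C * (w%:R + 1) * u by field; lra.
have vu2 : 2 * (v - u) <= v / 2.
  apply: le_trans wuv; rewrite ler_wpM2r// subr_ge0; exact: a_nd.
have : 0 <= (C - 8) * (u - w%:R * (v - u)).
  apply: mulr_ge0; lra.
lra.
Qed.

End sequence_facts.

(** * Powers of polynomials with nonnegative coefficients *)

(** Convolution of laws on the natural numbers is multiplication of generating
    polynomials: the coefficients of the n-th power of the jump polynomial are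
    the probabilities that n steps, all at most M, have a given sum. *)
Definition jump_poly (R : realType) (p : nat -> R) (M : nat) : {poly R} :=
  \poly_(j < M.+1) p j.

Section coefficientwise_order.
Variable R : realType.
Implicit Types q s t b : {poly R}.

Definition nneg_coefs q : Prop := forall i, 0 <= q`_i.

Lemma nneg_coefsD q s : nneg_coefs q -> nneg_coefs s -> nneg_coefs (q + s).
Proof. by move=> q0 s0 i; rewrite coefD addr_ge0. Qed.

Lemma nneg_coefsM q s : nneg_coefs q -> nneg_coefs s -> nneg_coefs (q * s).
Proof. by move=> q0 s0 i; rewrite coefM sumr_ge0// => j _; rewrite mulr_ge0. Qed.

Lemma nneg_coefsMn q n : nneg_coefs q -> nneg_coefs (q *+ n).
Proof. by move=> q0 i; rewrite coefMn mulrn_wge0. Qed.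

Lemma nneg_coefsX q n : nneg_coefs q -> nneg_coefs (q ^+ n).
Proof.
move=> q0; elim: n => [|n IH]; last by rewrite exprS; exact: nneg_coefsM.
by move=> i; rewrite expr0 coef1 ler0n.
Qed.

Lemma nneg_coefs_sum n (q : 'I_n -> {poly R}) (P : pred 'I_n) :
  (forall i, P i -> nneg_coefs (q i)) -> nneg_coefs (\sum_(i | P i) q i).
Proof. by move=> q0 i; rewrite coef_sum sumr_ge0// => j /q0. Qed.

Lemma nneg_coefs_subX q s n :
  nneg_coefs q -> nneg_coefs s -> nneg_coefs (q - s) ->
  nneg_coefs (q ^+ n - s ^+ n).
Proof.
move=> q0 s0 qs; rewrite subrXX; apply: nneg_coefsM => //.
by apply: nneg_coefs_sum => i _; apply: nneg_coefsM; exact: nneg_coefsX.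
Qed.

Lemma nneg_coefs_binomial1 t b n : nneg_coefs t -> nneg_coefs b ->
  nneg_coefs ((t + b) ^+ n.+1 - (b * t ^+ n) *+ n.+1).
Proof.
move=> t0 b0; rewrite exprDn (bigD1 (inord 1))//= inordK// bin1 expr1 subn1/=.
rewrite [t ^+ n * b]mulrC addrAC subrr add0r; apply: nneg_coefs_sum => i _.
by apply: nneg_coefsMn; apply: nneg_coefsM; exact: nneg_coefsX.
Qed.

End coefficientwise_order.

Section jump_poly.
Variables (R : realType) (p : nat -> R).
Hypothesis p_ge0 : forall j, 0 <= p j.

Lemma jump_poly_nneg M : nneg_coefs (jump_poly p M).
Proof. by move=> j; rewrite coef_poly; case: ifP. Qed.

(** One-big-jump lower bound: one of the n.+1 steps is long, the n others sum
    up to z <= w.  Since the long step exceeds w and the short ones do not, the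
    n.+1 positions of the long step give distinct terms. *)
Lemma one_big_jump (w x n : nat) (c : R) :
  (w < x - w)%N -> (forall z, (z <= w)%N -> c <= p (x - z)) ->
  n.+1%:R * c * (\sum_(z < w.+1) (jump_poly p w ^+ n)`_z)
    <= (jump_poly p x ^+ n.+1)`_x.
Proof.
move=> wx cp; pose t := jump_poly p w.
pose b : {poly R} := \poly_(j < x.+1) (if (x - w <= j)%N then p j else 0).
have t0 : nneg_coefs t by exact: jump_poly_nneg.
have b0 : nneg_coefs b.
  by move=> j; rewrite coef_poly; case: ifP => // _; case: ifP.
have rest0 : nneg_coefs (jump_poly p x - (t + b)).
  move=> j; rewrite coefB coefD !coef_poly.
  have := p_ge0 j; case: ifP; case: ifP; try case: ifP; lia || lra.
have big0 : (b * t ^+ n)`_x *+ n.+1 <= (jump_poly p x ^+ n.+1)`_x.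
  rewrite -coefMn -subr_ge0 -coefB.
  have -> : jump_poly p x ^+ n.+1 - b * t ^+ n *+ n.+1 =
      (jump_poly p x ^+ n.+1 - (t + b) ^+ n.+1) +
      ((t + b) ^+ n.+1 - b * t ^+ n *+ n.+1) by rewrite addrA subrK.
  apply: nneg_coefsD; last exact: nneg_coefs_binomial1.
  apply: nneg_coefs_subX => //; first exact: jump_poly_nneg.
  exact: nneg_coefsD.
apply: le_trans big0.
rewrite -mulrA -[leRHS]mulr_natl ler_wpM2l// coefMr mulr_sumr.
have wx1 : (w.+1 <= x.+1)%N by lia.
rewrite (big_ord_widen _ (fun z => c * (t ^+ n)`_z) wx1) big_mkcond/=.
apply: ler_sum => z _.
have tz : 0 <= (t ^+ n)`_z by exact: nneg_coefsX.
case: ifP => zw; last first.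
  by rewrite mulr_ge0.
rewrite ler_wpM2r// coef_poly ltnS leq_subr ifT; last by lia.
by apply: cp; lia.
Qed.

Lemma horner1_wide (q : {poly R}) N : (size q <= N)%N ->
  q.[1] = \sum_(i < N) q`_i.
Proof.
move=> qN; rewrite (horner_coef_wide _ qN).
by apply: eq_bigr => i _; rewrite expr1n mulr1.
Qed.

Lemma deriv_horner1_wide (q : {poly R}) N : (size q <= N)%N ->
  q^`().[1] = \sum_(i < N) i%:R * q`_i.
Proof.
move=> qN; rewrite (@horner1_wide _ N.-1); last first.
  by apply: leq_trans (size_poly _ _) _; lia.
case: N qN => [|N] qN; first by rewrite !big_ord0.
rewrite big_ord_recl/= mul0r add0r; apply: eq_bigr => i _.
by rewrite coef_deriv mulr_natl.
Qed.

Lemma bernoulli_exp (s : R) n : 0 <= s <= 1 -> 1 - n%:R * (1 - s) <= s ^+ n.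
Proof.
move=> /andP[s0 s1]; elim: n => [|n IH]; first by rewrite mul0r subr0 expr0.
have sn1 : s ^+ n <= 1 by rewrite exprn_ile1.
have : 0 <= (1 - s) * (1 - s ^+ n) by apply: mulr_ge0; lra.
rewrite exprS -natr1; lra.
Qed.

(** The union bound controls the event that some step exceeds w, and Markov's
    inequality the event that the short steps add up to more than w: the value
    at 1 of the n-th power is the probability that all steps are short, and
    its derivative at 1 is the mean of their sum on that event. *)
Lemma small_sum_ge (w n : nat) (tau m : R) :
  (0 < w)%N ->
  1 - tau <= \sum_(j < w.+1) p j <= 1 ->
  \sum_(j < w.+1) j%:R * p j <= m ->
  1 - n%:R * tau - n%:R * m / w%:R <=
    \sum_(z < w.+1) (jump_poly p w ^+ n)`_z.
Proof.
move=> w_gt0 /andP[ptau p1] pm.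
pose t := jump_poly p w; pose q := t ^+ n; pose N := maxn w.+1 (size q).
have w0 : 0 < w%:R :> R by rewrite ltr0n.
have st : (size t <= w.+1)%N by exact: size_poly.
have t1 : t.[1] = \sum_(j < w.+1) p j.
  by rewrite (horner1_wide st); apply: eq_bigr => j _; rewrite coef_poly ltn_ord.
have t'1 : t^`().[1] = \sum_(j < w.+1) j%:R * p j.
  rewrite (deriv_horner1_wide st); apply: eq_bigr => j _.
  by rewrite coef_poly ltn_ord.
have t10 : 0 <= t.[1] by rewrite t1 sumr_ge0.
have q0 i : 0 <= q`_i.
  exact/nneg_coefsX/jump_poly_nneg.
have qN : (size q <= N)%N by rewrite leq_maxr.
have q1 : 1 - n%:R * tau <= q.[1].
  rewrite horner_exp; apply: le_trans (bernoulli_exp n _); last first.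
    by rewrite t10 t1.
  rewrite t1 lerD2l lerN2 ler_wpM2l//; lra.
have q'1 : q^`().[1] <= n%:R * m.
  rewrite deriv_exp hornerMn hornerM horner_exp -[leLHS]mulr_natl ler_wpM2l//.
  apply: le_trans pm; rewrite t'1 ler_piMr ?sumr_ge0// => [i _|].
    exact: mulr_ge0.
  by rewrite exprn_ile1// t1.
have wN : (w.+1 <= N)%N by rewrite leq_maxl.
rewrite (big_ord_widen _ (fun z => q`_z) wN) big_mkcond/=.
apply: le_trans (_ : q.[1] - q^`().[1] / w%:R <= _).
  by rewrite lerB// ler_pM2r// invr_gt0.
rewrite (horner1_wide qN) (deriv_horner1_wide qN) mulr_suml -sumrB.
apply: ler_sum => i _; case: ifP => iw.
  by rewrite lerBlDr lerDl divr_ge0// mulr_ge0.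
rewrite subr_le0 mulrAC ler_peMl// ler_pdivlMr// mul1r ler_nat.
by move/negbT: iw; rewrite -ltnNge; lia.
Qed.

End jump_poly.

(** * Random walks with integer steps *)

Section laws_on_nat.
Context {R : realType}.
Implicit Types F : probability R R.

Definition nat_mass F (j : nat) : R := fine (F [set j%:R]).

Lemma nat_massE F j : (nat_mass F j)%:E = F [set j%:R].
Proof. by rewrite fineK// fin_num_measure. Qed.

Lemma nat_mass_ge0 F j : 0 <= nat_mass F j.
Proof. by rewrite fine_ge0. Qed.

(** The coefficient counts only the paths whose steps lie in {0, ..., M}; the
    other steps can only add mass to the law of the walk. *)
Lemma walk_law_ge F n M i :
  (((jump_poly (nat_mass F) M ^+ n)`_i)%:E <= walk_law F n [set i%:R])%E.
Proof.
elim: n i => [|n IH] i /=.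
  rewrite expr0 coef1 diracE lee_fin ler_nat.
  by case: eqP => [->|//]; rewrite mem_set.
set P := jump_poly (nat_mass F) M.
pose D (j : 'I_i.+1) : set (R * R) := [set j%:R] `*` [set (i - j)%:R].
have mD j : measurable (D j) by apply: measurableX.
have tD : trivIset setT D.
  move=> j k _ _ [[u v] [[/= uj _] [uk _]]].
  apply/val_inj/eqP; rewrite -(eqr_nat R); apply/eqP.
  by rewrite -uj -uk.
apply: (@le_trans _ _ ((walk_law F n \x F)%E (\big[setU/set0]_(j < i.+1) D j))).
  rewrite measure_semi_additive_ord//; last exact: bigsetU_measurable.
  rewrite exprSr coefM -sumEFin; apply: lee_sum => j _.
  rewrite [leRHS](_ : _ = (walk_law F n [set j%:R] * F [set (i - j)%:R])%E); last first.
    exact: product_measure1E.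
  rewrite EFinM; apply: lee_pmul => //.
  - by rewrite lee_fin; apply/nneg_coefsX/jump_poly_nneg/nat_mass_ge0.
  - by rewrite lee_fin; apply/jump_poly_nneg/nat_mass_ge0.
  - by rewrite coef_poly; case: ifP => _; rewrite ?nat_massE.
apply: le_measure; rewrite ?inE//; first exact: bigsetU_measurable.
- rewrite -[X in measurable X]setTI; apply: measurable_realfun.measurable_funD => //.
- rewrite -bigcup_mkord_ord => -[u v] [j _ [/= -> ->]].
  by rewrite -natrD subnKC// -ltnS.
Qed.

Definition nats : set R := [set x | exists n : nat, x = n%:R].

Lemma measurable_nats : measurable nats.
Proof.
have -> : nats = \bigcup_n [set n%:R].
  by apply/seteqP; split=> [x [n ->]|x [n _ ->]]; exists n.
exact: bigcup_measurable.
Qed.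

Section concentrated.
Variable F : probability R R.
Hypothesis F_nats : F (~` nats) = 0%E.

Lemma prob_setI_nats B : measurable B -> F B = F (B `&` nats).
Proof.
move=> mB; have mN := measurable_nats.
rewrite -[in LHS](setIT B) -(setUv nats) setIUr measureU//.
- rewrite [X in (_ + X)%E](_ : _ = 0%E) ?adde0//.
  apply/eqP; rewrite eq_le measure_ge0 andbT -F_nats le_measure ?inE//.
  + by apply: measurableI => //; exact: measurableC.
  + exact: measurableC.
- exact: measurableI.
- by apply: measurableI => //; exact: measurableC.
- by apply/seteqP; split=> [x /= [[Bx xN] [Bx2 /(_ xN)]]|].
Qed.

Lemma prob_unit_interval (x : R) n : n%:R <= x -> x < n.+1%:R ->
  F `]x - 1, x]%classic = F [set n%:R].
Proof.
move=> nx xn; rewrite prob_setI_nats//; congr (F _).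
rewrite -natr1 in xn.
apply/seteqP; split=> [y [+ [m ym]]|_ /= ->].
  rewrite ym/= in_itv/= => /andP[xm mx]; congr (_%:R); apply/eqP.
  have mn : (m < n.+1)%N by rewrite -(ltr_nat R) -natr1; lra.
  have nm : (n < m.+1)%N by rewrite -(ltr_nat R) -natr1; lra.
  by rewrite eqn_leq -ltnS mn.
by split; [rewrite in_itv/=; lra|exists n].
Qed.

Definition tail (i : nat) : R := fine (F `]i%:R, +oo[%classic).

Lemma tail_real (x : R) n : n%:R <= x -> x < n.+1%:R ->
  fine (F `]x, +oo[%classic) = tail n.
Proof.
move=> nx xn; rewrite /tail prob_setI_nats// [in RHS]prob_setI_nats//.
congr (fine (F _)); rewrite -natr1 in xn.
apply/seteqP; split=> y [+ [m ym]]; rewrite ym/= !in_itv/= !andbT => xm;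
  (split; last by exists m); first lra.
move: xm; rewrite ltr_nat -(ler_nat R) -natr1; lra.
Qed.

Lemma trivIset_nat_singletons n :
  trivIset setT (fun j : 'I_n => [set (j : nat)%:R : R]).
Proof.
move=> j k _ _ [u [/= uj uk]]; apply/val_inj/eqP.
by rewrite -(eqr_nat R) -uj uk.
Qed.

Lemma prob_segment i w : F (`]i%:R, w%:R]%classic `&` nats) =
  (\sum_(j < w.+1 | (i < j)%N) nat_mass F j)%:E.
Proof.
have -> : `]i%:R, w%:R]%classic `&` nats =
    \big[setU/set0]_(j < w.+1 | (i < j)%N) [set j%:R : R].
  rewrite -bigcup_seq_cond; apply/seteqP; split=> [y [+ [m ym]]|_ [j /= /andP[_ ij] ->]].
    rewrite ym/= in_itv/= ltr_nat ler_nat => /andP[im mw].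
    have mw1 : (m < w.+1)%N by [].
    by exists (Ordinal mw1) => //=; rewrite im mem_index_enum.
  by split; [rewrite in_itv/= ltr_nat ler_nat ij -ltnS ltn_ord|exists j].
rewrite measure_bigsetU_ord//; last exact: trivIset_nat_singletons.
by rewrite -sumEFin; apply: eq_bigr => j _; rewrite nat_massE.
Qed.

Lemma sum_mass_gt i w : \sum_(j < w.+1 | (i < j)%N) nat_mass F j <= tail i.
Proof.
rewrite -lee_fin -prob_segment /tail fineK ?fin_num_measure//.
apply: le_measure; rewrite ?inE//.
  by apply: measurableI => //; exact: measurable_nats.
by move=> x [/=]; rewrite !in_itv/= => /andP[-> _].
Qed.

Lemma sum_mass_le w : \sum_(j < w.+1) nat_mass F j = 1 - tail w.
Proof.
have mN := measurable_nats.
have := probability_setT F.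
have -> : [set: R] = `]-oo, w%:R]%classic `|` `]w%:R, +oo[%classic.
  apply/seteqP; split=> // x _ /=; rewrite !in_itv/= andbT.
  by have [xw|wx] := leP x w%:R; [left|right].
rewrite measureU//; last first.
  apply/seteqP; split=> // x [/=]; rewrite !in_itv/= andbT; lra.
rewrite [X in (_ + X)%E = _](_ : _ = (tail w)%:E); last first.
  by rewrite /tail fineK// fin_num_measure.
rewrite [X in (X + _)%E = _](_ : _ = F (`]-oo, w%:R]%classic `&` nats)); last first.
  exact: prob_setI_nats.
have -> : `]-oo, w%:R]%classic `&` nats =
    \big[setU/set0]_(j < w.+1) [set j%:R : R].
  rewrite -bigcup_seq; apply/seteqP; split=> [y [+ [m ym]]|_ [j /= _ ->]].
    rewrite ym/= in_itv/= ler_nat => mw.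
    have mw1 : (m < w.+1)%N by [].
    by exists (Ordinal mw1) => //=; rewrite mem_index_enum.
  by split; [rewrite in_itv/= ler_nat -ltnS ltn_ord|exists j].
rewrite measure_bigsetU_ord//; last exact: trivIset_nat_singletons.
rewrite [X in (X + _)%E = _](_ : _ = (\sum_(j < w.+1) nat_mass F j)%:E); last first.
  by rewrite -sumEFin; apply: eq_bigr => j _; exact/esym/nat_massE.
by rewrite -EFinD => -[<-]; rewrite addrK.
Qed.

Lemma sum_mean_le w :
  \sum_(j < w.+1) j%:R * nat_mass F j <= \sum_(i < w) tail i.
Proof.
apply: (@le_trans _ _ (\sum_(i < w) \sum_(j < w.+1 | (i < j)%N) nat_mass F j)).
  under [leRHS]eq_bigr do rewrite big_mkcond.
  rewrite exchange_big/=; apply: ler_sum => j _.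
  have jw : (j <= w)%N by rewrite -ltnS.
  rewrite -big_mkcond/= -(big_ord_widen _ (fun=> nat_mass F j) jw).
  by rewrite sumr_const card_ord mulr_natl.
by apply: ler_sum => i _; exact: sum_mass_gt.
Qed.

Lemma tail_ge0 i : 0 <= tail i.
Proof. by rewrite fine_ge0. Qed.

Lemma tail_le1 i : tail i <= 1.
Proof.
have : 0 <= \sum_(j < i.+1) nat_mass F j.
  by apply: sumr_ge0 => j _; exact: nat_mass_ge0.
by rewrite sum_mass_le subr_ge0.
Qed.

(** With D = K (1 + C), up to n = a w / (2 D) the n short steps add up to at
    most w with probability at least 1/2, so that the one-big-jump bound
    contributes (n + 1) c / 2 for each such n: the sum is quadratic in a w. *)
Lemma renewal_ge (a : nat -> R) (K C c : R) (w x : nat) :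
  0 < a w -> 0 < K -> 0 < C -> 0 <= c -> (0 < w)%N -> (w < x - w)%N ->
  tail w <= K / a w ->
  \sum_(i < w) tail i <= K * (C * w%:R / a w) ->
  (forall z, (z <= w)%N -> c <= nat_mass F (x - z)) ->
  ((c * (a w / (4 * (K * (1 + C)))) ^+ 2)%:E <= renewal F [set x%:R])%E.
Proof.
move=> aw0 K0 C0 c0 w0 wx tw mw cp.
set D := K * (1 + C).
have D0 : 0 < D by rewrite mulr_gt0// addr_gt0.
have wR : 0 < w%:R :> R by rewrite ltr0n.
set M := Num.truncn (a w / (2 * D)).
have M1 : a w / (2 * D) < M.+1%:R by exact: truncnS_gt.
have M0 : M%:R <= a w / (2 * D).
  by rewrite truncn_le; apply/ltW/divr_gt0 => //; rewrite mulr_gt0.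
apply: (@le_trans _ _ (\sum_(0 <= n < M.+2) walk_law F n [set x%:R])%E); last first.
  exact: nneseries_lim_ge.
rewrite big_nat_recl//= big_mkord.
apply: le_trans (leeDr _ _); last exact: measure_ge0.
apply: (@le_trans _ _ (\sum_(n < M.+1) (n.+1%:R * c / 2)%:E)%E); last first.
  apply: lee_sum => n _; apply: le_trans (walk_law_ge F n.+1 x x).
  rewrite lee_fin; apply: le_trans (one_big_jump (nat_mass_ge0 F) n wx cp).
  rewrite ler_wpM2l ?mulr_ge0//.
  apply: le_trans (@small_sum_ge _ _ (nat_mass_ge0 F) w n (K / a w)
    (K * (C * w%:R / a w)) w0 _ _).
  - have -> : 1 - n%:R * (K / a w) - n%:R * (K * (C * w%:R / a w)) / w%:R =
        1 - n%:R * (D / a w) by rewrite /D; field; rewrite !gt_eqF.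
    have : n%:R <= M%:R :> R by rewrite ler_nat -ltnS.
    move=> nM; have := le_trans nM M0 => nD.
    have : n%:R * (D / a w) <= a w / (2 * D) * (D / a w).
      by rewrite ler_wpM2r// divr_ge0// ltW.
    have -> : a w / (2 * D) * (D / a w) = 2^-1 by field; rewrite !gt_eqF.
    lra.
  - by rewrite sum_mass_le lerD2l lerN2 tw/= gerBl tail_ge0.
  - exact: le_trans (sum_mean_le w) mw.
rewrite sumEFin lee_fin -mulr_suml -mulr_suml.
have -> : \sum_(n < M.+1) n.+1%:R = M.+1%:R * M.+2%:R / 2 :> R.
  elim: (M) => [|m IH]; first by rewrite big_ord_recl big_ord0/= addr0 mul1r divff.
  rewrite big_ord_recr/= IH -[in RHS]natr1 -[m.+3%:R]natr1 -[m.+2%:R]natr1; lra.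
have -> : M.+1%:R * M.+2%:R / 2 * c / 2 = c * (M.+1%:R * M.+2%:R / 4) by field.
rewrite ler_wpM2l//.
have -> : (a w / (4 * D)) ^+ 2 = (a w / (2 * D)) * (a w / (2 * D)) / 4.
  by field; rewrite gt_eqF.
have aD0 : 0 <= a w / (2 * D) by apply/ltW/divr_gt0 => //; rewrite mulr_gt0.
have M2 : M.+1%:R <= M.+2%:R :> R by rewrite ler_nat.
by rewrite ler_pM2r// ler_pM// ltW// (lt_le_trans M1).
Qed.

End concentrated.
End laws_on_nat.

(** * Arithmetic span of a law on the natural numbers *)

Section lattice_laws.
Context {R : realType}.

Lemma measurable_lattice (h : R) : measurable (lattice h).
Proof.
have -> : lattice h = \bigcup_n ([set n%:R * h] `|` [set - (n%:R * h)]).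
  apply/seteqP; split=> [_ [[n|n] ->]|x [n _ [] ->]].
  - by exists n => //; left.
  - by exists n.+1 => //; right; rewrite /= NegzE mulrNz mulNr.
  - by exists n%:Z.
  - by exists (- n%:Z); rewrite mulrNz mulNr.
by apply: bigcup_measurable => n _; exact: measurableU.
Qed.

(** The support makes F arithmetic with span at least 1, and the atom at 1
    forces 1 to be a multiple of the span. *)
Lemma admissible_step_nats (F : probability R R) (h : R) :
  F (~` nats) = 0%E -> 0 < nat_mass F 1 -> admissible_step F h -> h = 1.
Proof.
move=> F_nats F1 [h0 ha].
have mN := @measurable_nats R.
have F_lattice1 : supported_by_lattice F 1.
  rewrite /supported_by_lattice prob_setI_nats//; last exact: measurable_lattice.
  rewrite (_ : _ `&` _ = setT `&` nats); last first.
    by apply/seteqP; split=> x [_ [n ->]]; split; [|exists n| |exists n] => //;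
       exists n%:Z; rewrite mulr1.
  by rewrite -prob_setI_nats//; exact: probability_setT.
have /ha[_ Fh hmax] : Defs.arithmetic F by exists 1.
have h1 : 1 <= h by apply: hmax.
have [k kh] : lattice h 1.
  apply: contrapT => nh.
  have : (F (lattice h) <= F (~` [set 1%:R]))%E.
    apply: le_measure; rewrite ?inE//.
    - exact: measurable_lattice.
    - exact: measurableC.
    - by move=> x + /= x1; rewrite x1 => hx; exact: nh hx.
  rewrite Fh probability_setC// -nat_massE -EFinB lee_fin; lra.
have k0 : 0 < k by rewrite -(ltr0z R) -(pmulr_lgt0 _ h0) -kh.
have : 1 <= k%:~R :> R by rewrite -[1]/(1%:~R) ler_int.
move=> k1; apply/eqP; rewrite eq_le h1 andbT.
by rewrite [leRHS]kh ler_peMl// ltW.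
Qed.

End lattice_laws.

(** * Laws made of blocks of atoms *)

Section block_measures.
Context {R : realType}.

(** Atoms of mass c k at each of the len k consecutive integers from lo k on;
    both the regular part and the spikes of the law built below have this
    form. *)
Definition block_sum (c : nat -> R) (lo len : nat -> nat) (B : set R) : \bar R :=
  (\sum_(k <oo) (c k * \sum_(j < len k) \1_B (lo k + j)%:R)%:E)%E.

Lemma block_sum_measure (c : nat -> R) (lo len : nat -> nat) :
  (forall k, 0 <= c k) ->
  exists m : {measure set R -> \bar R}, forall B, m B = block_sum c lo len B.
Proof.
move=> c0.
pose m k : {measure set R -> \bar R} :=
  mscale (NngNum (c0 k)) (msum (fun j => \d_((lo k + j)%:R : R)) (len k)).
exists (mseries m 0) => B; apply: eq_eseriesr => k _.
rewrite /m /= /mscale/= /msum EFinM -sumEFin.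
by congr (_ * _)%E; apply: eq_bigr => j _; rewrite diracE.
Qed.

Lemma block_sum_disjoint_nats (c : nat -> R) (lo len : nat -> nat) (B : set R) :
  B `&` nats = set0 -> block_sum c lo len B = 0%E.
Proof.
move=> B0; apply: eseries0 => k _ _; rewrite big1 ?mulr0// => j _.
rewrite indicE memNset// => Bj.
have : (B `&` nats) (lo k + j)%:R by split => //; exists (lo k + j)%N.
by rewrite B0.
Qed.

(** The missing mass goes to the point 1, so that the arithmetic span of a law
    on the natural numbers built in this way is 1. *)
Lemma exists_law (m1 m2 : {measure set R -> \bar R}) :
  (m1 [set: R] + m2 [set: R] <= (2^-1)%:E)%E ->
  exists F : probability R R, exists2 rho : R, 0 < rho &
    forall B, F B = (m1 B + m2 B + (rho * \1_B 1)%:E)%E.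
Proof.
move=> m12.
have fin : (m1 [set: R] + m2 [set: R])%E \is a fin_num.
  by rewrite ge0_fin_numE ?adde_ge0//; apply: le_lt_trans m12 _; rewrite ltry.
pose rho := 1 - fine (m1 [set: R] + m2 [set: R])%E.
have rho0 : 0 < rho.
  rewrite subr_gt0; apply: (@le_lt_trans _ _ 2^-1).
    by rewrite -lee_fin fineK.
  by rewrite invf_lt1// ltr1n.
pose m : {measure set R -> \bar R} :=
  measure_add (measure_add m1 m2) (mscale (NngNum (ltW rho0)) \d_(1 : R)).
have mE B : m B = (m1 B + m2 B + (rho * \1_B 1)%:E)%E.
  transitivity (measure_add m1 m2 B + mscale (NngNum (ltW rho0)) \d_(1%R : R) B)%E.
    exact: measure_addE.
  by congr (_ + _)%E; exact: measure_addE.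
have mT : m [set: R] = 1%E.
  by rewrite mE indicT mulr1 -[X in (X + _)%E]fineK// -EFinD addrC subrK.
exists (mnormalize m \d_(0 : R)), rho => // B.
rewrite /= /mnormalize mT/= onee_eq0/= invr1 mule1; exact: mE.
Qed.

(** The three bounds on the spikes (total mass, tail, points) are all instances
    of this comparison. *)
Lemma nneseries_le_geometric (u : nat -> R) (C theta : R) (K : nat) :
  0 <= C -> 0 <= theta -> theta < 1 ->
  (forall k, 0 <= u k) -> (forall k, (k < K)%N -> u k = 0) ->
  (forall k, (K <= k)%N -> u k <= C * theta ^+ k) ->
  (\sum_(k <oo) (u k)%:E <= (C * theta ^+ K / (1 - theta))%:E)%E.
Proof.
move=> C0 t0 t1 u0 uK uC.
have t10 : 0 < 1 - theta by rewrite subr_gt0.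
(* The partial sum plus the geometric tail does not increase with m. *)
have partial m : \sum_(0 <= k < m) u k + C * theta ^+ (maxn K m) / (1 - theta)
    <= C * theta ^+ K / (1 - theta).
  elim: m => [|m IH]; first by rewrite big_nil maxn0 add0r.
  rewrite big_nat_recr//=; apply: le_trans IH; rewrite -addrA lerD2l.
  have [mK|Km] := ltnP m K.
    by rewrite uK// add0r !(maxn_idPl _)// ltnW.
  rewrite !(maxn_idPr _)//; last exact: leq_trans Km _.
  have -> : C * theta ^+ m / (1 - theta) =
      C * theta ^+ m + C * theta ^+ m.+1 / (1 - theta).
    by rewrite exprS; field; rewrite gt_eqF.
  by rewrite lerD2r uC.
apply: lime_le; first by apply: is_cvg_nneseries => k _ _; rewrite lee_fin.
apply: nearW => m; rewrite sumEFin lee_fin; apply: le_trans (partial m).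
by rewrite lerDl divr_ge0// ?mulr_ge0 ?exprn_ge0// ltW.
Qed.

Lemma block_sum_telescope (a q : nat -> R) (N n : nat) :
  (forall M, exists m0, forall m, (m0 <= m)%N -> M <= a m) ->
  (forall k, (k < N)%N -> q k = 0) ->
  (forall k, (N <= k)%N -> q k = (a k.-1)^-1 - (a k)^-1) ->
  (N <= n.+1)%N ->
  block_sum q id (fun=> 1%N) `]n%:R, +oo[%classic = ((a n)^-1)%:E.
Proof.
move=> aoo q0 qE Nn; rewrite /block_sum.
have qB k : q k * \sum_(j < 1) \1_(`]n%:R, +oo[%classic) (k + j)%:R =
    if (n < k)%N then (a k.-1)^-1 - (a k)^-1 else 0.
  rewrite big_ord1 addn0 indicE.
  case: ifPn => nk.
    rewrite mem_set ?mulr1 ?qE//; first by lia.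
    by rewrite /= in_itv/= ltr_nat nk.
  by rewrite memNset ?mulr0//= in_itv/= ltr_nat andbT; exact/negP.
apply: cvg_lim => //.
have partial m : (n < m)%N ->
    \sum_(0 <= k < m) (if (n < k)%N then (a k.-1)^-1 - (a k)^-1 else 0) =
    (a n)^-1 - (a m.-1)^-1.
  elim: m => // m IH; rewrite ltnS leq_eqVlt => /predU1P[<-|nm].
    rewrite subrr big_nat big1// => k /andP[_ kn].
    by rewrite ltnNge -ltnS kn.
  by rewrite big_nat_recr//= IH// nm/= addrA subrK.
apply: (@cvg_trans _ ((fun m => ((a n)^-1 - (a m.-1)^-1)%:E) @ \oo)).
  apply: near_eq_cvg; near=> m.
  rewrite -partial; last by near: m; exact: nbhs_infty_gt.
  by rewrite -sumEFin; apply: eq_bigr => k _; rewrite qB.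
apply: cvg_EFin; first exact: nearW.
have -> : (fine \o (fun m => ((a n)^-1 - (a m.-1)^-1)%:E)) =
   (fun m => (a n)^-1 - (a m.-1)^-1) by [].
rewrite -[X in _ --> X]subr0; apply: cvgB; first exact: cvg_cst.
apply/cvgrPdist_le => e e0.
have [m0 am0] := aoo (e^-1).
near=> m.
have am : e^-1 <= a m.-1.
  by apply: am0; near: m; exists m0.+1 => // i /=; lia.
have ei : 0 < e^-1 by rewrite invr_gt0.
rewrite sub0r normrN ger0_norm ?invr_ge0; last by lra.
rewrite -[leRHS]invrK lef_pV2 ?posrE//; lra.
Unshelve. all: by end_near. Qed.

End block_measures.

(** * A regular law with spikes *)

Lemma small_power (R : realType) (q e : R) : 0 <= q -> q < 1 -> 0 < e ->
  exists K, forall k, (K <= k)%N -> q ^+ k <= e.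
Proof.
move=> q0 q1 e0.
have /cvgrPdist_le/(_ _ e0)[K _ HK] : (fun k => q ^+ k) @ \oo --> (0 : R).
  by apply: cvg_expr; rewrite ger0_norm.
exists K => k Kk; have := HK k Kk.
by rewrite sub0r normrN ger0_norm// exprn_ge0.
Qed.

Section spiked_law.
Variables (R : realType) (a z : nat -> R) (n0 : nat) (r : R).
Hypotheses (a_gt0 : forall n, 0 < a n)
  (a_nd : {homo a : m n / (m <= n)%N >-> m <= n})
  (a_incr : forall n, (n0 <= n)%N -> a n.+1 - a n <= a n.+1 / (2 * n%:R))
  (a_oo : forall M, exists m0, forall m, (m0 <= m)%N -> M <= a m)
  (a_double : forall n, (n0 <= n)%N -> a (2 * n)%N <= r * a n)
  (r_gt0 : 0 < r) (r_lt : r ^+ 2 < 2)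
  (z_nd : forall m n, (0 < m)%N -> (m <= n)%N -> z m <= z n)
  (z_oo : forall M, exists m0, forall m, (m0 <= m)%N -> M <= z m).

(** The mass ratio of the spikes, chosen with r ^+ 2 < sigma < 2: the spike
    number k has relative width 2 ^- k, so that its mass relative to the tail is
    of order (sigma / 2) ^+ k, which is summable, while its contribution to the
    renewal measure relative to a x / x is at least of order
    (sigma / r ^+ 2) ^+ k, which is unbounded. *)
Definition sigma : R := (r ^+ 2 + 2) / 2.
Definition theta : R := sigma / 2.

Lemma sigma_gt0 : 0 < sigma.
Proof. by rewrite divr_gt0// addr_gt0// exprn_gt0. Qed.

Lemma r2_lt_sigma : r ^+ 2 < sigma.
Proof. move: r_lt; rewrite /sigma; lra. Qed.

Lemma theta_ge0 : 0 <= theta.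
Proof. by rewrite divr_ge0// ltW// sigma_gt0. Qed.

Lemma theta_lt1 : theta < 1.
Proof. move: r_lt; rewrite /theta /sigma; lra. Qed.

Lemma a_doubleX n k : (n0 <= n)%N -> a (2 ^ k * n)%N <= r ^+ k * a n.
Proof.
move=> n0n; elim: k => [|k IH]; first by rewrite expn0 mul1n expr0 mul1r.
rewrite expnS -mulnA exprS -mulrA; apply: le_trans (a_double _) _.
  by apply: leq_trans n0n _; rewrite leq_pmull// expn_gt0.
by rewrite ler_pM2l.
Qed.

(** The clauses make the spikes escape to infinity, put their widths in the
    range of Karamata's bound, bound their total mass by 1/4, and let z absorb
    their height, with a factor 2 ^+ k to spare because spikes may overlap. *)
Definition width_spec (k w : nat) : Prop :=
  [/\ (k < w)%N, (n0.+2 <= w)%N, 4 / (1 - theta) <= a w &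
      2 ^+ k * sigma ^+ k <= z w].

Lemma exists_width k : exists w, width_spec k w.
Proof.
have [m1 am1] := a_oo (4 / (1 - theta)).
have [m2 zm2] := z_oo (2 ^+ k * sigma ^+ k).
exists (k.+1 + n0.+2 + m1 + m2)%N; split; [lia|lia| |].
- by apply: am1; lia.
- by apply: zm2; lia.
Qed.

Definition width (k : nat) : nat := projT1 (cid (exists_width k)).

Lemma widthP k : width_spec k (width k).
Proof. exact: projT2 (cid (exists_width k)). Qed.

Definition spike (k : nat) : nat := (2 ^ k.+2 * width k)%N.
Definition spike_lo (k : nat) : nat := (spike k - width k)%N.
Definition spike_len (k : nat) : nat := (width k).+1.
Definition spike_mass (k : nat) : R := sigma ^+ k / ((spike k)%:R * a (spike k)).

Lemma width_gt k : (k < width k)%N. Proof. by case: (widthP k). Qed.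

Lemma width_gt0 k : (0 < width k)%N.
Proof. exact: leq_ltn_trans (width_gt k). Qed.

Lemma spikeE k : spike k = (2 ^ k * (4 * width k))%N.
Proof. by rewrite /spike -[k.+2]addn2 expnD -mulnA. Qed.

Lemma spike_ge k : (4 * width k <= spike k)%N.
Proof. by rewrite spikeE leq_pmull// expn_gt0. Qed.

Lemma spike_gt0 k : (0 < spike k)%N.
Proof. have := spike_ge k; have := width_gt0 k; lia. Qed.

Lemma spike_lo_ge k : (width k <= spike_lo k)%N.
Proof. rewrite /spike_lo; have := spike_ge k; lia. Qed.

Lemma spike_mass_gt0 k : 0 < spike_mass k.
Proof.
by rewrite divr_gt0 ?exprn_gt0 ?sigma_gt0// mulr_gt0// ltr0n spike_gt0.
Qed.

Lemma spike_mass_ge0 k : 0 <= spike_mass k.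
Proof. exact/ltW/spike_mass_gt0. Qed.

Lemma spike_mass_len k :
  spike_mass k * (spike_len k)%:R <= theta ^+ k / a (spike k).
Proof.
have x0 : 0 < (spike k)%:R :> R by rewrite ltr0n spike_gt0.
have ax := a_gt0 (spike k).
have lx : (spike_len k)%:R <= (spike k)%:R / 2 ^+ k :> R.
  rewrite ler_pdivlMr ?exprn_gt0// -natrX -natrM ler_nat mulnC spikeE.
  rewrite leq_pmul2l ?expn_gt0// /spike_len; have := width_gt0 k; lia.
apply: (@le_trans _ _ (spike_mass k * ((spike k)%:R / 2 ^+ k))).
  by rewrite ler_pM2l// spike_mass_gt0.
rewrite /spike_mass /theta (expr_div_n sigma) le_eqVlt; apply/orP; left; apply/eqP.
have : 0 < 2 ^+ k :> R by rewrite exprn_gt0.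
set T := 2 ^+ k => T0; set S := sigma ^+ k; set x := (spike k)%:R in x0 *.
by field; rewrite !gt_eqF.
Qed.

(** Atoms of tail 1 / a n beyond m, with nothing on {0, ..., m}. *)
Definition base (m : nat) (k : nat) : R :=
  if (k < m.+1)%N then 0 else (a k.-1)^-1 - (a k)^-1.

Lemma base_ge0 m k : 0 <= base m k.
Proof.
rewrite /base; case: ifP => // /negbT; rewrite -leqNgt => mk.
by rewrite subr_ge0 lef_pV2 ?posrE// a_nd// leq_pred.
Qed.

Lemma base_le m k : (n0.+2 <= m)%N -> (m < k)%N ->
  base m k <= 2 / (k%:R * a k).
Proof.
move=> n0m mk; rewrite /base ltnS leqNgt mk/=.
case: k mk => // k mk /=.
have k1 : 1 <= k%:R :> R by rewrite ler1n; lia.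
have n0k : (n0 <= k)%N by lia.
have k0 : (0 < k)%N by lia.
have := a_incr n0k; have := le_succ_double a_gt0 a_incr n0k k0.
have := a_gt0 k; have := a_gt0 k.+1; rewrite -[k.+1%:R]natr1.
set u := a k; set v := a k.+1 => v0 u0 vu uv.
have kR : 0 < k%:R :> R by lra.
have -> : u^-1 - v^-1 = (v - u) / (u * v) by field; rewrite !gt_eqF.
apply: (@le_trans _ _ (v / (2 * k%:R) / (u * v))).
  by rewrite ler_pM2r// invr_gt0 mulr_gt0.
have -> : v / (2 * k%:R) / (u * v) = (2 * k%:R * u)^-1.
  by field; rewrite !gt_eqF.
have kv0 : 0 < (k%:R + 1) * v by rewrite mulr_gt0//; lra.
rewrite -[leLHS]div1r ler_pdivrMr ?(mulr_gt0, ltr0n)// mulrAC ler_pdivlMr//.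
have : v * (k%:R + 1) <= 2 * u * (2 * k%:R) by apply: ler_pM => //; lra.
lra.
Qed.

Definition spikes := block_sum spike_mass spike_lo spike_len.

Lemma spikes_le (B : set R) (C th : R) (K : nat) :
  0 <= C -> 0 <= th -> th < 1 ->
  (forall k, (k < K)%N -> forall j, (j <= width k)%N -> ~ B (spike_lo k + j)%:R) ->
  (forall k, (K <= k)%N ->
    spike_mass k * \sum_(j < spike_len k) \1_B (spike_lo k + j)%:R <= C * th ^+ k) ->
  (spikes B <= (C * th ^+ K / (1 - th))%:E)%E.
Proof.
move=> C0 th0 th1 BK BC; apply: nneseries_le_geometric => // k.
  by rewrite mulr_ge0 ?spike_mass_ge0// sumr_ge0.
move=> kK; rewrite big1 ?mulr0// => j _.
by rewrite indicE memNset//; apply: BK => //; rewrite -ltnS ltn_ord.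
Qed.

Lemma spikes_sum_le (B : set R) k :
  spike_mass k * \sum_(j < spike_len k) \1_B (spike_lo k + j)%:R <=
  theta ^+ k / a (spike k).
Proof.
apply: le_trans (spike_mass_len k); rewrite ler_pM2l ?spike_mass_gt0//.
rewrite -[leRHS]mulr1 mulr_natl -[in leRHS](card_ord (spike_len k)) -sumr_const.
by apply: ler_sum => j _; rewrite indicE lern1 leq_b1.
Qed.

Lemma spikes_setT : (spikes [set: R] <= (4^-1)%:E)%E.
Proof.
have t1 : 0 < 1 - theta by rewrite subr_gt0 theta_lt1.
have -> : 4^-1 = (1 - theta) / 4 * theta ^+ 0 / (1 - theta) :> R.
  by rewrite expr0; field; rewrite gt_eqF.
apply: spikes_le => //; [|exact: theta_ge0|exact: theta_lt1|move=> k _].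
  by rewrite divr_ge0// ltW.
apply: le_trans (spikes_sum_le _ _) _.
have [_ _ aw _] := widthP k.
have wx : a (width k) <= a (spike k) by apply: a_nd; have := spike_ge k; lia.
rewrite mulrC ler_wpM2r ?exprn_ge0 ?theta_ge0//.
rewrite -[leRHS]invrK lef_pV2 ?posrE ?invr_gt0 ?divr_gt0//.
by rewrite invf_div; exact: le_trans aw wx.
Qed.

(** Only the spikes to the right of n count, and a n <= a (spike k) for these. *)
Lemma spikes_tail (K n : nat) : (forall k, (k < K)%N -> (spike k <= n)%N) ->
  (spikes `]n%:R, +oo[%classic <= ((a n)^-1 * theta ^+ K / (1 - theta))%:E)%E.
Proof.
move=> Kn; apply: spikes_le => //.
- by rewrite invr_ge0 ltW.
- exact: theta_ge0.
- exact: theta_lt1.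
- move=> k kK j jw; rewrite /= in_itv/= ltr_nat => /andP[nj _].
  have := Kn _ kK; move: nj; rewrite /spike_lo; have := spike_ge k; lia.
move=> k _; have [xn|nx] := leqP (spike k) n.
  rewrite big1 ?mulr0 ?mulr_ge0 ?invr_ge0 ?exprn_ge0 ?theta_ge0 ?(ltW (a_gt0 _))//.
  move=> j _; rewrite indicE memNset//= in_itv/= ltr_nat => /andP[nj _].
  move: nj (ltn_ord j); rewrite /spike_lo /spike_len; have := spike_ge k; lia.
apply: le_trans (spikes_sum_le _ _) _; rewrite mulrC.
rewrite ler_wpM2r ?exprn_ge0 ?theta_ge0//.
by rewrite lef_pV2 ?posrE// a_nd// ltnW.
Qed.

(** If spike k charges n then width k <= n <= spike k, hence its mass at n is at
    most sigma ^+ k / (n a n), and the choice of the widths makes sigma ^+ k at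
    most 2 ^- k z n. *)
Lemma spikes_point (n : nat) : (0 < n)%N -> 0 <= z n ->
  (spikes [set n%:R] <= (2 * (z n / (n%:R * a n)))%:E)%E.
Proof.
move=> n0' z0.
have nR : 0 < n%:R :> R by rewrite ltr0n.
have zn0 : 0 <= z n / (n%:R * a n) by rewrite divr_ge0// mulr_ge0// ltW.
have -> : 2 * (z n / (n%:R * a n)) =
    z n / (n%:R * a n) * (2^-1) ^+ 0 / (1 - 2^-1) :> R.
  rewrite expr0 mulr1 [LHS]mulrC; congr (_ * _).
  by have -> : 1 - 2^-1 = 2^-1 :> R; [lra|rewrite invrK].
apply: spikes_le => //; [by rewrite invf_lt1// ltr1n|move=> k _].
have rhs0 : 0 <= z n / (n%:R * a n) * 2^-1 ^+ k.
  by rewrite mulr_ge0// exprn_ge0.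
have [|nin] := boolP ((spike_lo k <= n)%N && (n <= spike k)%N); last first.
  rewrite big1 ?mulr0// => j _; rewrite indicE memNset//= => /eqP.
  rewrite eqr_nat => /eqP jn; move/negP: nin; apply.
  move: (ltn_ord j) jn; rewrite /spike_lo /spike_len; have := spike_ge k; lia.
move=> /andP[ln nx].
have wn : (width k <= n)%N := leq_trans (spike_lo_ge k) ln.
have sum1 : \sum_(j < spike_len k) \1_[set n%:R : R] (spike_lo k + j)%:R <= 1 :> R.
  have jn : (n - spike_lo k < spike_len k)%N.
    move: ln nx; rewrite /spike_lo /spike_len; have := spike_ge k; lia.
  rewrite (bigD1 (Ordinal jn))//= big1 ?addr0; last first.
    move=> j /eqP jE; rewrite indicE memNset//= => /eqP; rewrite eqr_nat => /eqP e.
    apply: jE; apply: val_inj => /=; move: e ln; lia.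
  by rewrite indicE lern1 leq_b1.
apply: (@le_trans _ _ (spike_mass k)).
  by rewrite -[leRHS]mulr1 ler_pM2l// spike_mass_gt0.
have [_ _ _ zw] := widthP k.
have sz : sigma ^+ k <= z n * 2^-1 ^+ k.
  rewrite exprVn ler_pdivlMr ?exprn_gt0// mulrC; apply: (le_trans zw).
  exact: z_nd (width_gt0 k) wn.
rewrite /spike_mass mulrAC; apply: ler_pM => //.
- by rewrite exprn_ge0// ltW// sigma_gt0.
- by rewrite invr_ge0 mulr_ge0// ltW.
rewrite lef_pV2 ?posrE ?mulr_gt0 ?ltr0n ?spike_gt0//.
by rewrite ler_pM ?ler_nat ?a_nd// ltW.
Qed.

Lemma spikes_in_block (k j : nat) : (j <= width k)%N ->
  ((spike_mass k)%:E <= spikes [set (spike k - j)%:R])%E.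
Proof.
move=> jw; have xk := spike_ge k.
have u0 i : (0 <= (spike_mass i * \sum_(l < spike_len i)
    \1_[set (spike k - j)%:R : R] (spike_lo i + l)%:R)%:E)%E.
  by rewrite lee_fin mulr_ge0 ?spike_mass_ge0// sumr_ge0.
apply: le_trans (nneseries_lim_ge k.+1 (fun i _ _ => u0 i)).
rewrite big_nat_recr//=; apply: le_trans (leeDr _ _); last first.
  by apply: sume_ge0 => i _; exact: u0.
rewrite lee_fin -[leLHS]mulr1 ler_pM2l ?spike_mass_gt0//.
have lt : (width k - j < spike_len k)%N by rewrite /spike_len; lia.
rewrite (bigD1 (Ordinal lt))//= -[leLHS]addr0; apply: lerD; last exact: sumr_ge0.
rewrite indicE mem_set//=; congr (_%:R).
rewrite /spike_lo; lia.
Qed.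

Lemma base_setT m :
  block_sum (base m) id (fun=> 1%N) [set: R] = ((a m)^-1)%:E.
Proof.
rewrite -(@block_sum_telescope _ a (base m) m.+1 m)//.
- apply: eq_eseriesr => k _; rewrite !big_ord1 !indicE addn0 in_setT.
  rewrite /base; case: ltnP => mk; first by rewrite !mul0r.
  by rewrite mem_set//= in_itv/= ltr_nat mk.
- by move=> k km; rewrite /base km.
- by move=> k mk; rewrite /base ltnNge mk.
Qed.

Lemma base_tail m n : (m <= n)%N ->
  block_sum (base m) id (fun=> 1%N) `]n%:R, +oo[%classic = ((a n)^-1)%:E.
Proof.
move=> mn; apply: (@block_sum_telescope _ a (base m) m.+1 n) => //.
- by move=> k km; rewrite /base km.
- by move=> k mk; rewrite /base ltnNge mk.
Qed.

Lemma base_point m n :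
  block_sum (base m) id (fun=> 1%N) [set n%:R] = (base m n)%:E.
Proof.
have u0 i : (0 <= (base m i * \sum_(j < 1) \1_[set n%:R : R] (i + j)%:R)%:E)%E.
  by rewrite lee_fin mulr_ge0 ?base_ge0// sumr_ge0.
rewrite /block_sum (nneseriesD1 (n := n))//.
rewrite eseries0 ?adde0; first last.
  move=> i _ /=; rewrite big_ord1 addn0 indicE => /negP iN.
  by rewrite memNset ?mulr0//= => /eqP; rewrite eqr_nat.
by rewrite big_ord1 addn0 indicE mem_set// mulr1.
Qed.

(** At the point x = spike k, with w = width k, one big jump into the spike
    gives the renewal measure a mass of order spike_mass k * a w ^+ 2, and
    a x <= r ^+ k.+2 * a w by doubling, whence the factor
    (sigma / r ^+ 2) ^+ k over a x / x. *)
Theorem exists_spiked_law : exists F : probability R R,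
  [/\ F (~` nats) = 0%E, 0 < nat_mass F 1,
     tail F n * a n @[n --> \oo] --> (1 : R),
     (exists N, forall n, (N <= n)%N ->
        nat_mass F n <= 4 * (z n / (n%:R * a n))) &
     forall (D : R) (N : nat), 0 < D -> exists2 x, (N <= x)%N &
        ((D * (a x / x%:R))%:E <= renewal F [set x%:R])%E].
Proof.
have [m0 am0] := a_oo 4.
pose m := (m0 + n0.+2)%N.
have am : 4 <= a m by apply: am0; rewrite leq_addr.
have n0m : (n0.+2 <= m)%N by rewrite leq_addl.
have [mb mbE] := block_sum_measure id (fun=> 1%N) (base_ge0 m).
have [ms msE] := block_sum_measure spike_lo spike_len spike_mass_ge0.
have tot : (mb [set: R] + ms [set: R] <= (2^-1)%:E)%E.
  have -> : 2^-1 = 4^-1 + 4^-1 :> R by field.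
  rewrite EFinD; apply: leeD; last by rewrite msE; exact: spikes_setT.
  by rewrite mbE base_setT lee_fin lef_pV2 ?posrE.
have [F [rho rho0 FE]] := exists_law tot.
exists F.
have F_nats : F (~` nats) = 0%E.
  rewrite FE mbE msE !block_sum_disjoint_nats ?setICl// !add0e indicE memNset ?mulr0//.
  by apply; exists 1%N.
have F_tail n : (m <= n)%N ->
    F `]n%:R, +oo[%classic = (((a n)^-1)%:E + spikes `]n%:R, +oo[%classic)%E.
  move=> mn; rewrite FE mbE msE base_tail// indicE memNset ?mulr0 ?adde0//=.
  by rewrite in_itv/= -[1]/(1%:R) ltr_nat => /andP[+ _]; lia.
have F_point n : (1 < n)%N -> F [set n%:R] = ((base m n)%:E + spikes [set n%:R])%E.
  move=> n1; rewrite FE mbE msE base_point indicE memNset ?mulr0 ?adde0//=.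
  by move/eqP; rewrite -[1]/(1%:R) eqr_nat; lia.
have F_ge_spike B : measurable B -> (spikes B <= F B)%E.
  move=> mB; rewrite FE mbE msE -/(spikes B) -addeA addeCA; apply: leeDl.
  by rewrite adde_ge0 -?mbE// lee_fin mulr_ge0// ltW.
have t1 : 0 < 1 - theta by rewrite subr_gt0 theta_lt1.
have tailE : tail F n * a n @[n --> \oo] --> (1 : R).
  apply/cvgrPdist_le => e e0.
  have e1 : 0 < e * (1 - theta) by rewrite mulr_gt0.
  have [K HK] := small_power theta_ge0 theta_lt1 e1.
  exists (m + \sum_(k < K) spike k)%N => // n /= mn.
  have an := a_gt0 n.
  have Kn k : (k < K)%N -> (spike k <= n)%N.
    move=> kK; apply: leq_trans mn; apply: leq_trans (leq_addl _ _).
    by rewrite (bigD1 (Ordinal kK))//= leq_addr.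
  have := F_tail n (leq_trans (leq_addr _ _) mn).
  have := spikes_tail Kn.
  have : (0 <= spikes `]n%:R, +oo[%classic)%E by rewrite /spikes -msE.
  rewrite /tail; case: (spikes _) => [s|//|//]; rewrite !lee_fin => s0 sK ->/=.
  rewrite mulrDl mulVf ?gt_eqF// opprD addrA subrr sub0r normrN.
  rewrite ger0_norm; last by rewrite mulr_ge0// ltW.
  apply: (@le_trans _ _ ((a n)^-1 * theta ^+ K / (1 - theta) * a n)).
    by rewrite ler_pM2r.
  have -> : (a n)^-1 * theta ^+ K / (1 - theta) * a n = theta ^+ K / (1 - theta).
    by rewrite mulrC mulrA mulVKf ?gt_eqF.
  by rewrite ler_pdivrMr//; exact: HK.
have [Nt HNt] : exists N, forall n, (N <= n)%N -> tail F n <= 2 / a n.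
  have lt12 : 1 < 2 :> R by rewrite ltr1n.
  have [N _ HN] := cvgr_le _ tailE _ lt12.
  by exists N => n Nn; rewrite ler_pdivlMr//; exact: HN.
have tail_le i : tail F i <= (2 + a Nt) / a i.
  have ai := a_gt0 i; have aNt := a_gt0 Nt.
  have [Ni|iN] := leqP Nt i.
    by apply: (le_trans (HNt _ Ni)); rewrite ler_pM2r ?invr_gt0// lerDl ltW.
  rewrite ler_pdivlMr//; apply: (@le_trans _ _ (a i)).
    by rewrite ler_piMl ?tail_le1// ltW.
  by apply: ler_wpDl => //; apply: a_nd; exact: ltnW.
split => //.
- by rewrite -lte_fin nat_massE FE (lt_le_trans _ (leeDr _ _)) ?adde_ge0//
    indicE mem_set// mulr1 lte_fin.
- have [Nz HNz] := z_oo 1.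
  exists (m.+2 + Nz)%N => n Nn.
  have n_gt0 : (0 < n)%N by lia.
  have z1 : 1 <= z n by apply: HNz; lia.
  have nR : 0 < n%:R :> R by rewrite ltr0n.
  have an := a_gt0 n.
  rewrite -lee_fin nat_massE F_point; last by lia.
  have -> : 4 * (z n / (n%:R * a n)) =
      2 * (z n / (n%:R * a n)) + 2 * (z n / (n%:R * a n)) by lra.
  rewrite EFinD; apply: leeD; last by apply: spikes_point => //; lra.
  rewrite lee_fin; apply: (le_trans (base_le n0m _)); first by lia.
  rewrite mulrA ler_pM2r ?invr_gt0 ?mulr_gt0//; lra.
move=> D N D0.
have [C C0 HC] := sum_inv_le a_gt0 a_nd a_incr.
set K := 2 + a Nt in tail_le.
have K0 : 0 < K by rewrite addr_gt0.
pose E := 4 * (K * (1 + C)).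
have E0 : 0 < E by rewrite !mulr_gt0// addr_gt0.
have s0 := sigma_gt0; have r20 : 0 < r ^+ 2 by rewrite exprn_gt0.
have q0 : 0 <= r ^+ 2 / sigma by rewrite divr_ge0// ltW.
have q1 : r ^+ 2 / sigma < 1 by rewrite ltr_pdivrMr// mul1r r2_lt_sigma.
have E2 : 0 < E ^+ 2 by exact: exprn_gt0.
have r4 : 0 < r ^+ 4 by exact: exprn_gt0.
have M0 : 0 < D * E ^+ 2 * r ^+ 4 by exact: mulr_gt0 (mulr_gt0 D0 E2) r4.
have e0 : 0 < (D * E ^+ 2 * r ^+ 4)^-1 by rewrite invr_gt0.
have [k0 Hk0] := small_power q0 q1 e0.
have [k kk0 Nk] : exists2 k, (k0 <= k)%N & (N <= k)%N.
  by exists (k0 + N)%N; rewrite ?leq_addr ?leq_addl.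
have xw := spike_ge k; have wk := width_gt k.
exists (spike k); first by clear -Nk xw wk; lia.
have [_ n0w _ _] := widthP k.
have aw := a_gt0 (width k).
have U : ((spike_mass k * (a (width k) / E) ^+ 2)%:E <=
    renewal F [set (spike k)%:R])%E.
  apply: (renewal_ge F_nats aw K0 C0 (spike_mass_ge0 k) (width_gt0 k)).
  - by clear -xw wk; lia.
  - exact: tail_le.
  - apply: (@le_trans _ _ (\sum_(i < width k) K * (a i)^-1)).
      by apply: ler_sum => i _; exact: tail_le.
    by rewrite -mulr_sumr ler_wpM2l ?(ltW K0)//; exact: HC.
  - move=> y yw; rewrite -lee_fin nat_massE.
    by apply: le_trans (F_ge_spike _ _) => //; exact: spikes_in_block.
apply: le_trans U.
rewrite lee_fin.
have := Hk0 k kk0.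
have : a (spike k) <= r ^+ k.+2 * a (width k) by apply: a_doubleX; clear -n0w; lia.
have ax := a_gt0 (spike k).
have x0 : 0 < (spike k)%:R :> R by rewrite ltr0n spike_gt0.
rewrite /spike_mass (expr_div_n (r ^+ 2)) -exprM mulnC -addn2 exprD.
rewrite [r ^+ (k * 2)%N]exprM.
move: (a (spike k)) (a (width k)) (spike k)%:R ax aw x0 => u v x u0 v0 x0.
have rk0 : 0 < r ^+ k by rewrite exprn_gt0.
have sk0 : 0 < sigma ^+ k by rewrite exprn_gt0.
move: (r ^+ k) (sigma ^+ k) rk0 sk0 => p s p0 sk0 up.
rewrite ler_pdivrMr// -[_^-1 * s]mulrC ler_pdivlMr// => pD.
have prv : 0 < p * r ^+ 2 * v by exact: mulr_gt0 (mulr_gt0 p0 r20) v0.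
have u2 : u ^+ 2 <= (p * r ^+ 2 * v) ^+ 2.
  by rewrite lerXn2r ?nnegrE// ltW.
have xuE : 0 < x * u * E ^+ 2 by exact: mulr_gt0 (mulr_gt0 x0 u0) E2.
rewrite -(ler_pM2r xuE).
have -> : s / (x * u) * (v / E) ^+ 2 * (x * u * E ^+ 2) = s * v ^+ 2.
  by field; rewrite !gt_eqF.
have -> : D * (u / x) * (x * u * E ^+ 2) = D * E ^+ 2 * u ^+ 2.
  by field; rewrite !gt_eqF.
apply: (@le_trans _ _ (D * E ^+ 2 * (p * r ^+ 2 * v) ^+ 2)).
  by rewrite ler_pM2l// mulr_gt0.
have -> : D * E ^+ 2 * (p * r ^+ 2 * v) ^+ 2 = p ^+ 2 * (D * E ^+ 2 * r ^+ 4) * v ^+ 2 by ring.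
by rewrite ler_pM2r ?exprn_gt0.
Qed.

End spiked_law.

(** * Failure of the strong renewal theorem *)

Lemma le_renewal (R : realType) (F : probability R R) (B D : set R) :
  measurable B -> measurable D -> B `<=` D -> (renewal F B <= renewal F D)%E.
Proof.
move=> mB mD BD; apply: lee_nneseries => n _ //.
by apply: le_measure; rewrite ?inE.
Qed.

(** Whatever Y is, the constant in the strong renewal theorem is a real number
    C, so points x where the renewal mass is more than 2 C A x / x refute it;
    if C <= 0 the ratio is nonpositive (this covers an infinite moment too, for
    which C is 0). *)
Lemma not_SRT (R : realType) (alpha : R) (A : R -> R) (F Y : probability R R) :
  (forall x, 0 <= x -> 0 < A x) ->
  (forall (D : R) (N : nat), 0 < D -> exists2 x, (N <= x)%N &
     ((D * (A x%:R / x%:R))%:E <= renewal F [set x%:R])%E) ->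
  ~ SRT alpha A F Y 1.
Proof.
move=> Agt0 spikes; rewrite /SRT => /fine_cvgP[fin /cvgrPdist_lt/(_ _ ltr01) lim].
have [N HN] : exists N : nat, forall x : R, N%:R <= x ->
  let v := (renewal F `](x - 1)%R, x]%classic *
     ((SRT_const alpha Y * 1 * A x / x)^-1)%:E)%E in
  v \is a fin_num /\ `|1 - fine v| < 1.
  by apply: near_pinfty_nat; near do split.
move: (SRT_const alpha Y) HN => C HN.
(* The summand 1 keeps D positive when C = 0. *)
pose D := 2 * `|C| + 1.
have D0 : 0 < D by rewrite ltr_wpDl// mulr_ge0.
have [x Nx Ux] := spikes D N.+1 D0.
have x0 : 0 < x%:R :> R by rewrite ltr0n; lia.
have Ax : 0 < A x%:R by apply: Agt0; exact: ltW.
have [|] := HN x%:R; first by rewrite ler_nat; lia.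
have {}Ux : ((D * (A x%:R / x%:R))%:E <= renewal F `](x%:R - 1)%R, x%:R]%classic)%E.
  apply: le_trans Ux _; apply: le_renewal => // y -> /=.
  by rewrite in_itv/= lexx andbT ltrBlDr ltrDl.
set U := renewal F _ in Ux *; rewrite mulr1.
have U0 : (0 <= U)%E by apply: le_trans Ux; rewrite lee_fin mulr_ge0 ?divr_ge0 ?ltW.
have [C0|C0] := leP C 0.
  move=> vfin; apply/negP; rewrite -leNgt ler_normr; apply/orP; left.
  rewrite lerBrDl gerDr -lee_fin fineK//; apply: mule_ge0_le0 => //.
  by rewrite lee_fin invr_le0 -mulrA mulr_le0_ge0// divr_ge0// ltW.
move=> vfin; apply/negP; rewrite -leNgt ler_normr; apply/orP; right.
rewrite opprB lerBrDr -[1 + 1]/(2 : R) -lee_fin fineK//.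
have q0 : 0 < C * A x%:R / x%:R by rewrite divr_gt0 ?mulr_gt0//.
apply: (@le_trans _ _ ((D * (A x%:R / x%:R))%:E * ((C * A x%:R / x%:R)^-1)%:E)%E).
  rewrite -EFinM lee_fin ler_pdivlMr// /D gtr0_norm//.
  have Axx : 0 <= A x%:R / x%:R by rewrite divr_ge0// ltW.
  by rewrite [leRHS]mulrDl mul1r -!mulrA lerDl.
by apply: lee_pmul => //; rewrite lee_fin ?invr_ge0 ?mulr_ge0 ?divr_ge0// ltW.
Unshelve. all: by end_near. Qed.

Unset Implicit Arguments.

Theorem proposition1p6 (R : realType) (alpha : R) (A zeta : R -> R)
    (alpha_gt0 : 0 < alpha) (alpha_lt : alpha < 2^-1)
    (A_RV : RV alpha A) (A_norm : normalized alpha A)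
    (zeta_gt0 : forall x : R, 0 < x -> 0 < zeta x)
    (zeta_nd : forall x y : R, 0 < x -> x <= y -> zeta x <= zeta y)
    (zeta_oo : zeta x @[x --> +oo] --> +oo) :
  exists F : probability R R,
    [/\ F `[0, +oo[%classic = 1%E,
        asymp (fun x => fine (F `]x, +oo[%classic)) (fun x => (A x)^-1) &
        forall h : R, admissible_step F h ->
          bigO_pinfty (fun x => fine (F `]x - h, x]%classic))
                      (fun x => zeta x / (x * A x)) /\
          forall Y : probability R R,
            rescaled_walk_cvg F (norming A) Y -> ~ SRT alpha A F Y h].
Proof.
have [Agt0 Aincr _ _ _ _ _] := A_norm.
have A_nd x y : 0 <= x -> x <= y -> A x <= A y.
  by move=> x0; rewrite le_eqVlt => /predU1P[->//|xy]; apply/ltW/Aincr.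
have [r [r0 r2 [n1 A_double]]] := RV_double alpha_lt Agt0 A_RV.
have [n2 A_incr] := normalized_increment alpha_gt0 alpha_lt A_norm.
pose n0 := (n1 + n2)%N.
have a_gt0 (n : nat) : 0 < A n%:R by exact: Agt0.
have a_nd : {homo (fun n : nat => A n%:R) : m n / (m <= n)%N >-> m <= n}.
  by move=> m n mn; apply: A_nd => //; rewrite ler_nat.
have a_incr n : (n0 <= n)%N -> A n.+1%:R - A n%:R <= A n.+1%:R / (2 * n%:R).
  by move=> n0n; apply: A_incr; rewrite /n0 in n0n; lia.
have a_oo M : exists m0, forall m, (m0 <= m)%N -> M <= A m%:R.
  have /cvgryPge/(_ M)/near_pinfty_nat[N HN] :=
    normalized_cvg_pinfty alpha_gt0 A_RV A_norm.
  by exists N => m Nm; apply: HN; rewrite ler_nat.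
have z_oo M : exists m0, forall m : nat, (m0 <= m)%N -> M <= zeta m%:R.
  have /cvgryPge/(_ M)/near_pinfty_nat[N HN] := zeta_oo.
  by exists N => m Nm; apply: HN; rewrite ler_nat.
have a_double n : (n0 <= n)%N -> A (2 * n)%:R <= r * A n%:R.
  by move=> n0n; apply: A_double; rewrite /n0 in n0n; lia.
have z_nd m n : (0 < m)%N -> (m <= n)%N -> zeta m%:R <= zeta n%:R.
  by move=> m0 mn; apply: zeta_nd; rewrite ?ltr0n ?ler_nat.
have [F [F_nats F1 F_tail [N1 F_mass] F_renewal]] :=
  exists_spiked_law a_gt0 a_nd a_incr a_oo a_double r0 r2 z_nd z_oo.
exists F; split.
- rewrite prob_setI_nats// (_ : _ `&` _ = setT `&` nats).
    by rewrite -prob_setI_nats//; exact: probability_setT.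
  apply/seteqP; split=> x [_ [n ->]]; (split; last by exists n) => //=.
  by rewrite in_itv/= ler0n.
- rewrite /asymp.
  have ratio1 : A (Num.truncn x)%:R / A x @[x --> +oo] --> (1 : R).
    apply/cvgrPdist_le => e e0.
    apply: (@nat_near_pinfty _ _ (n0.+1 + (Num.truncn e^-1).+1)%N) => x Nx.
    have [nx xn] := truncn_bounds (le_trans (ler0n _ _) Nx).
    have := le_truncn Nx; move: (Num.truncn x) nx xn => n nx xn Nn.
    have n0n := leq_trans (leq_addr _ _) Nn; have en := leq_trans (leq_addl _ _) Nn.
    have n_gt0 : 0 < n%:R :> R by rewrite ltr0n (leq_trans _ n0n).
    have x0 : 0 <= x by lra.
    have Ax := Agt0 _ x0.
    have nxA : A n%:R <= A x by apply: A_nd.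
    have xnA : A x <= A n.+1%:R by apply: A_nd => //; exact: ltW.
    have ne : n%:R^-1 <= e.
      rewrite -[leRHS]invrK lef_pV2 ?posrE ?invr_gt0//.
      by apply/ltW/(lt_le_trans (truncnS_gt _)); rewrite ler_nat.
    have lo : 1 - n%:R^-1 <= A n%:R / A n.+1%:R.
      apply: (succ_ratio a_gt0 a_incr); first exact: ltnW.
      exact: leq_ltn_trans n0n.
    have mid : A n%:R / A n.+1%:R <= A n%:R / A x.
      by rewrite ler_pM2l// lef_pV2 ?posrE.
    have hi : A n%:R / A x <= 1 by rewrite ler_pdivrMr// mul1r.
    by rewrite ger0_norm; lra.
  have : tail F (Num.truncn x) * A (Num.truncn x)%:R *
      (A (Num.truncn x)%:R / A x)^-1 @[x --> +oo] --> (1 * 1^-1 : R).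
    apply: cvgM; first exact: (cvg_truncn F_tail).
    by apply: (@cvgV _ _ _ _ (fun x => A (Num.truncn x)%:R / A x)) => //; exact: oner_neq0.
  rewrite invr1 mulr1; apply: cvg_trans; apply: near_eq_cvg.
  apply: (@nat_near_pinfty _ _ 0) => x x0.
  have [nx xn] := truncn_bounds x0.
  rewrite (tail_real F_nats nx xn) invrK.
  have Ax := Agt0 _ x0; have An := a_gt0 (Num.truncn x).
  by field; rewrite !gt_eqF.
move=> h /(admissible_step_nats F_nats F1) ->; split; last first.
  by move=> Y _; exact: not_SRT.
(* 4 from the bound at n, and 2 * 2 from x <= 2 n and A x <= 2 A n. *)
exists 16; apply: (@nat_near_pinfty _ _ (N1 + n0.+1)%N) => x Nx.
have [nx xn] := truncn_bounds (le_trans (ler0n _ _) Nx).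
rewrite (prob_unit_interval F_nats nx xn) -/(nat_mass F _).
have := le_truncn Nx; move: (Num.truncn x) nx xn => n nx xn Nn.
have N1n := leq_trans (leq_addr _ _) Nn; have n0n := leq_trans (leq_addl _ _) Nn.
have n_gt0 : (0 < n)%N by exact: leq_ltn_trans n0n.
have n0R : 0 < n%:R :> R by rewrite ltr0n.
have n1R : 1 <= n%:R :> R by rewrite ler1n.
have x0 : 0 < x by exact: lt_le_trans nx.
have Ax := Agt0 _ (ltW x0); have An := a_gt0 n.
have xn2 : x <= 2 * n%:R by rewrite -natr1 in xn; lra.
have Axn : A x <= 2 * A n%:R.
  apply: le_trans (le_succ_double a_gt0 a_incr (ltnW n0n) n_gt0).
  by apply: A_nd; apply: ltW.
have zx := zeta_gt0 _ x0.
rewrite ger0_norm ?nat_mass_ge0// ger0_norm; last first.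
  by rewrite divr_ge0 ?mulr_ge0// ltW.
have -> : 16 * (zeta x / (x * A x)) = 4 * (zeta x / (x * A x / 4)).
  by field; rewrite !gt_eqF.
apply: (le_trans (F_mass _ N1n)).
rewrite ler_pM2l//; apply: ler_pM.
- by rewrite ltW// zeta_gt0.
- by rewrite invr_ge0 mulr_ge0// ltW.
- exact: zeta_nd.
rewrite lef_pV2 ?posrE ?divr_gt0 ?mulr_gt0//.
have : x * A x <= (2 * n%:R) * (2 * A n%:R) by apply: ler_pM => //; exact: ltW.
lra.
Qed.
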